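(* Let $u_0\in(0,1)$. Assume $\eta(X)$ has an atomless distribution and consider only scoring functions $s$ for which $s(X)$ has an atomless distribution. Then: (1) for every such $s$ and every such $s^*\in\mathcal S^*$, $W(s,u_0)\le W(s^*,u_0)$; (2) for every such $s$, \[ W(s,u_0)=\frac p2\,\beta(s,u_0)\big(2-\beta(s,u_0)\big)+(1-p)\,\mathrm{LocAUC}(s,u_0). \]
   Context: $(X,Y)$ random pair in $\mathcal X\times\{-1,+1\}$, $(X',Y')$ an independent copy, $\eta(x)=\mathbb P\{Y=1\mid X=x\}$, $p=\mathbb P\{Y=1\}\in(0,1)$. For a scoring function $s$, $F_s$ is the cdf of $s(X)$, $Q(s,v)=\inf\{t:F_s(t)\ge v\}$, $C_{s,u}=\{x:s(x)\ge Q(s,1-u)\}$, $C^*_u=C_{\eta,u}$, $\beta(s,u)=\mathbb P\{s(X)\ge Q(s,1-u)\mid Y=1\}$, and $\mathrm{LocAUC}(s,u)=\mathbb P\{s(X)>s(X'),\ s(X)\ge Q(s,1-u)\mid Y=1,Y'=-1\}$. With $\Phi_{u_0}(v)=v\,\mathbb I\{v>1-u_0\}$, the $W$-criterion at rate $u_0$ is $W(s,u_0)=\mathbb E\big(\Phi_{u_0}(F_s(s(X)))\mid Y=1\big)$. $\mathcal S^*$ is the set of scoring functions $s^*$ with $s^*(x)=\eta(x)$ for $x\in C^*_{u_0}$ and $s^*(x)<\inf_{C^*_{u_0}}\eta$ for $x\notin C^*_{u_0}$. *)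

(* Defs.v *)
From HB Require Import structures.
From mathcomp Require Import all_boot all_order all_algebra.
From mathcomp Require Import all_classical all_reals all_analysis.
Set Implicit Arguments. Unset Strict Implicit. Unset Printing Implicit Defensive.
Import Order.TTheory GRing.Theory Num.Theory.
Local Open Scope classical_set_scope.
Local Open Scope ring_scope.

Section Defs.
Context {R : realType} {d : measure_display} {T : measurableType d}
        {dx : measure_display} {Xs : measurableType dx}.
Variable P : probability T R.

Definition prob (A : set T) : R := fine (P A).

Definition cdf (Z : T -> R) (t : R) : R := prob [set w | Z w <= t].

Definition quantile (Z : T -> R) (v : R) : R := inf [set t | v <= cdf Z t].

Definition ppos (Y : T -> R) : R := prob [set w | Y w = 1].

Definition Phi (u0 v : R) : R := if 1 - u0 < v then v else 0.

Definition Wcrit (X : T -> Xs) (Y : T -> R) (s : Xs -> R) (u0 : R) : R :=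
  fine (\int[P]_w ((Phi u0 (cdf (s \o X) (s (X w))) * (Y w == 1)%:R)%:E))%E
  / ppos Y.

Definition Cset (X : T -> Xs) (s : Xs -> R) (u : R) : set Xs :=
  [set x | quantile (s \o X) (1 - u) <= s x].

Definition beta (X : T -> Xs) (Y : T -> R) (s : Xs -> R) (u : R) : R :=
  prob [set w | quantile (s \o X) (1 - u) <= s (X w) /\ Y w = 1] / ppos Y.

Definition LocAUC (X X' : T -> Xs) (Y Y' : T -> R) (s : Xs -> R) (u : R) : R :=
  prob [set w | s (X' w) < s (X w) /\ quantile (s \o X) (1 - u) <= s (X w)
                /\ Y w = 1 /\ Y' w = -1]
  / prob [set w | Y w = 1 /\ Y' w = -1].

Definition Sstar (X : T -> Xs) (eta : Xs -> R) (u0 : R) (s : Xs -> R) : Prop :=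
  (forall x, Cset X eta u0 x -> s x = eta x) /\
  (forall x, ~ Cset X eta u0 x -> s x < inf (eta @` Cset X eta u0)).

Definition atomless (Z : T -> R) : Prop :=
  forall t : R, P [set w | Z w = t] = 0%E.

(* eta is (a version of) the regression function x |-> P{Y = 1 | X = x} *)
Definition regression (X : T -> Xs) (Y : T -> R) (eta : Xs -> R) : Prop :=
  measurable_fun setT eta /\ (forall x, 0 <= eta x <= 1) /\
  forall B : set Xs, measurable B ->
    P (X @^-1` B `&` [set w | Y w = 1]) = (\int[P]_(w in X @^-1` B) (eta (X w))%:E)%E.

(* (X',Y') is an independent copy of (X,Y): same joint law, and independence
   (stated on measurable rectangles, which generate the product sigma-algebra) *)
Definition indep_copy (X X' : T -> Xs) (Y Y' : T -> R) : Prop :=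
  (forall (A : set Xs) (B : set R), measurable A -> measurable B ->
     P (X @^-1` A `&` Y @^-1` B) = P (X' @^-1` A `&` Y' @^-1` B)) /\
  (forall (A1 A2 : set Xs) (B1 B2 : set R),
     measurable A1 -> measurable B1 -> measurable A2 -> measurable B2 ->
     P (X @^-1` A1 `&` Y @^-1` B1 `&` (X' @^-1` A2 `&` Y' @^-1` B2)) =
     (P (X @^-1` A1 `&` Y @^-1` B1) * P (X' @^-1` A2 `&` Y' @^-1` B2))%E).

End Defs.

(* Main.v *)
Require Import Defs.
From HB Require Import structures.
From mathcomp Require Import all_boot all_order all_algebra.
From mathcomp Require Import all_classical all_reals all_analysis.
From mathcomp Require Import measurable_realfun ring lra.
Import Order.TTheory GRing.Theory Num.Theory.
Import numFieldNormedType.Exports.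
Local Open Scope classical_set_scope.
Local Open Scope ring_scope.

(* For [s(X)] atomless with cdf [F], [F(s(X))] is uniform, so the events
   [{F(s(X)) > a}] have mass [1 - a] whatever [s] is. By the layer-cake formula
   [p W] integrates over [r >= 0] the numbers [P(Phi(F(s(X))) > r, Y = 1)]; each
   of these is the integral of [eta(X)] over such an event with
   [a = max(r, 1 - u0)], hence by Neyman-Pearson largest when the event is a
   superlevel set of [eta(X)], which it is for every score in [Sstar].

   For the decomposition, Fubini turns [p W] into
   [P(s(X') <= s(X), s(X) >= Q, Y = 1)]. The part on [Y' = -1] is
   [p (1 - p) LocAUC]. On [Y' = 1] write [b = p beta]: if also [s(X') >= Q], the
   two copies are exchangeable and have no ties, which gives [b^2 / 2];
   otherwise [s(X') < Q <= s(X)] gives [b (p - b)]. *)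

(** * Measurability of preimages and of sets cut out by comparing two functions *)

Section Measurable.
Set Implicit Arguments.
Unset Strict Implicit.
Context {R : realType} {d : measure_display} {T : measurableType d}.

Lemma measurable_preimage {d' : measure_display} {T' : measurableType d'}
    (f : T -> T') (A : set T') :
  measurable_fun setT f -> measurable A -> measurable (f @^-1` A).
Proof. by move=> mf mA; rewrite -[X in measurable X]setTI; exact: mf. Qed.

Lemma measurable_set_ltr (f g : T -> R) :
  measurable_fun setT f -> measurable_fun setT g ->
  measurable [set w | f w < g w].
Proof.
move=> mf mg.
exact: (measurable_preimage (measurable_fun_ltr mf mg) (A := [set true])).
Qed.

Lemma measurable_set_ler (f g : T -> R) :
  measurable_fun setT f -> measurable_fun setT g ->
  measurable [set w | f w <= g w].
Proof.
move=> mf mg.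
exact: (measurable_preimage (measurable_fun_ler mf mg) (A := [set true])).
Qed.

Lemma measurable_set_eqr (f g : T -> R) :
  measurable_fun setT f -> measurable_fun setT g ->
  measurable [set w | f w = g w].
Proof.
move=> mf mg; rewrite (_ : [set w | _] =
    [set w | f w <= g w] `&` [set w | g w <= f w]).
  by apply: measurableI; exact: measurable_set_ler.
apply/seteqP; split => w /=; first by move->.
by move=> [fg gf]; apply/le_anti/andP.
Qed.

End Measurable.

(** * Real-valued probabilities, cdfs and quantiles of atomless variables *)

Section Prob.
Set Implicit Arguments.
Unset Strict Implicit.
Context {R : realType} {d : measure_display} {T : measurableType d}.
Variable P : probability T R.
Implicit Types (A B N : set T) (Z : T -> R).

Lemma prob_EFin A : measurable A -> (prob P A)%:E = P A.
Proof. by move=> mA; rewrite /prob fineK// fin_num_measure. Qed.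

Lemma prob_ge0 A : 0 <= prob P A.
Proof. by rewrite /prob fine_ge0. Qed.

Lemma probD A B : measurable A -> measurable B -> A `&` B = set0 ->
  prob P (A `|` B) = prob P A + prob P B.
Proof.
move=> mA mB AB0; apply: EFin_inj.
by rewrite EFinD !prob_EFin ?measureU//; exact: measurableU.
Qed.

Lemma prob_split A B : measurable A -> measurable B ->
  prob P A = prob P (A `&` B) + prob P (A `&` ~` B).
Proof.
move=> mA mB; have mBc := measurableC mB.
rewrite -probD; [|exact: measurableI..|].
  by rewrite -setIUr setUv setIT.
by rewrite setIACA setIid setICr setI0.
Qed.

Lemma le_prob A B : measurable A -> measurable B -> A `<=` B ->
  prob P A <= prob P B.
Proof.
by move=> mA mB AB; rewrite -lee_fin !prob_EFin// le_measure ?inE.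
Qed.

Lemma probT : prob P setT = 1.
Proof. by rewrite /prob probability_setT. Qed.

Lemma probC A : measurable A -> prob P (~` A) = 1 - prob P A.
Proof.
move=> mA; have := prob_split measurableT mA.
by rewrite !setTI probT => ->; rewrite addrC addKr.
Qed.

(** The tool for passing between strict and weak inequalities, or between two cut points, when the
    difference is a null event. *)
Lemma prob_negligible_eq A B N : measurable A -> measurable B ->
  measurable N -> P N = 0%E -> A `&` ~` N = B `&` ~` N -> prob P A = prob P B.
Proof.
move=> mA mB mN N0 ABN.
have null C : measurable C -> prob P (C `&` N) = 0.
  move=> mC; apply/le_anti; rewrite prob_ge0 andbT.
  by rewrite (le_trans (le_prob _ _ (@subIsetr _ C N)))// /prob ?N0//;
    exact: measurableI.
by rewrite (prob_split mA mN) (prob_split mB mN) ABN !null.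
Qed.

Lemma cdf_homo Z : measurable_fun setT Z ->
  {homo Defs.cdf P Z : t r / t <= r}.
Proof.
move=> mZ t r tr; apply: le_prob; try exact: measurable_set_ler.
by move=> w /= /le_trans; apply.
Qed.

Lemma cdfr_le1 Z t : measurable_fun setT Z -> Defs.cdf P Z t <= 1.
Proof.
by move=> mZ; rewrite -probT; apply: le_prob => //; exact: measurable_set_ler.
Qed.

(** Bridge to the library cdf, whose right-continuity and limits at infinity are imported below. *)
Lemma cdf_distribution (Z : {RV P >-> R}) t :
  Defs.cdf P Z t = fine (random_variable.cdf Z t).
Proof.
rewrite /Defs.cdf /prob; congr (fine (P _)).
Qed.

(** Right-continuity of the cdf, as a bound that passes to the limit [r] -> [t] from the right. *)
Lemma cdf_right_ge Z (a t : R) : measurable_fun setT Z ->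
  (forall r, t < r -> a <= Defs.cdf P Z r) -> a <= Defs.cdf P Z t.
Proof.
move=> mZ aF; pose Zr : {RV P >-> R} := mfun_Sub (mem_set mZ).
have ZE r : Defs.cdf P Z r = fine (random_variable.cdf Zr r).
  exact: (cdf_distribution Zr).
rewrite -lee_fin ZE fineK ?fin_num_measure//.
have := @cdf_right_continuous _ _ _ P Zr t; apply: cvge_ge.
near=> r.
have tr : t < r by near: r; exact: nbhs_right_gt.
have -> : random_variable.cdf Zr r = (fine (random_variable.cdf Zr r))%:E.
  by rewrite fineK ?fin_num_measure.
by rewrite -ZE lee_fin aF.
Unshelve. all: by end_near. Qed.


Lemma atomless_lt Z t : measurable_fun setT Z -> atomless P Z ->
  prob P [set w | Z w < t] = Defs.cdf P Z t.
Proof.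
move=> mZ aZ; have mle := measurable_set_ler mZ (measurable_cst t).
have mlt := measurable_set_ltr mZ (measurable_cst t).
have meq := measurable_set_eqr mZ (measurable_cst t).
apply: (prob_negligible_eq mlt mle meq (aZ t)).
apply/seteqP; split => w /= [Zt neq]; split => //; first exact: ltW.
by rewrite lt_neqAle Zt andbT; apply/eqP.
Qed.

(* Right-continuity of the cdf of [- Z]. *)
Lemma cdf_left_le Z (a t : R) : measurable_fun setT Z -> atomless P Z ->
  (forall r, r < t -> Defs.cdf P Z r <= a) -> Defs.cdf P Z t <= a.
Proof.
move=> mZ aZ Fa.
have cdfN r : Defs.cdf P (\- Z) r = 1 - Defs.cdf P Z (- r).
  rewrite -(atomless_lt (- r) mZ aZ) -probC.
    congr prob; apply/seteqP; split => w /=.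
      by move=> Zr; apply/negP; rewrite -leNgt lerNl.
    by move/negP; rewrite -leNgt lerNl.
  exact: measurable_set_ltr.
suff : 1 - a <= Defs.cdf P (\- Z) (- t).
  by rewrite cdfN opprK lerD2l lerN2.
apply: cdf_right_ge; first exact: measurableT_comp.
by move=> r tr; rewrite cdfN lerD2l lerN2 Fa// ltrNl.
Qed.

(** Points left of [inf D] are outside [D], so left-continuity gives the upper bound; each point
    right of [inf D] dominates an element of [D], so right-continuity gives the lower one. This
    serves both [{F >= a}] (the quantile) and [{F > a}] (the threshold). *)
Lemma cdf_inf Z (a : R) (D : set R) : measurable_fun setT Z -> atomless P Z ->
  D !=set0 -> has_lbound D -> (forall t, D t -> a <= Defs.cdf P Z t) ->
  (forall t, ~ D t -> Defs.cdf P Z t <= a) -> Defs.cdf P Z (inf D) = a.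
Proof.
move=> mZ aZ D0 lD aD Da; apply/le_anti/andP; split.
  apply: cdf_left_le => // r rD; apply: Da => Dr.
  by move: rD; rewrite ltNge ge_inf.
apply: cdf_right_ge => // r /inf_lt[//|t Dt tr].
by rewrite (le_trans (aD _ Dt))// cdf_homo// ltW.
Qed.

Lemma cdf_gt_exists Z (a : R) : measurable_fun setT Z -> a < 1 ->
  exists t, a < Defs.cdf P Z t.
Proof.
move=> mZ a1; pose Zr : {RV P >-> R} := mfun_Sub (mem_set mZ).
have : (fine (random_variable.cdf Zr r) @[r --> +oo] --> (1 : R))%classic.
  by apply/fine_cvg; exact: cvg_cdfy1.
move=> /cvgr_gt /(_ _ a1) /= near_gt.
have [t] := @filter_ex _ (pinfty_nbhs R) _ _ near_gt.
by rewrite -(cdf_distribution Zr); exists t.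
Qed.

Lemma cdf_lt_exists Z (a : R) : measurable_fun setT Z -> 0 < a ->
  exists t, Defs.cdf P Z t < a.
Proof.
move=> mZ a1; pose Zr : {RV P >-> R} := mfun_Sub (mem_set mZ).
have : (fine (random_variable.cdf Zr r) @[r --> -oo] --> (0 : R))%classic.
  by apply/fine_cvg; exact: cvg_cdfNy0.
move=> /cvgr_lt /(_ _ a1) /= near_lt.
have [t] := @filter_ex _ (ninfty_nbhs R) _ _ near_lt.
by rewrite -(cdf_distribution Zr); exists t.
Qed.

Lemma cdf_has_lbound Z (a : R) : measurable_fun setT Z -> 0 < a ->
  has_lbound [set t | a <= Defs.cdf P Z t].
Proof.
move=> mZ a0; have [r Fr] := cdf_lt_exists mZ a0.
exists r => t /= aF; rewrite leNgt; apply/negP => tr.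
by move: (lt_le_trans Fr aF); rewrite ltNge cdf_homo// ltW.
Qed.

Lemma cdf_quantile Z (a : R) : measurable_fun setT Z -> atomless P Z ->
  0 < a < 1 -> Defs.cdf P Z (quantile P Z a) = a.
Proof.
move=> mZ aZ /andP[a0 a1]; apply: cdf_inf => //.
- by have [t /ltW] := cdf_gt_exists mZ a1; exists t.
- exact: cdf_has_lbound.
- by move=> t /negP; rewrite -ltNge => /ltW.
Qed.

(** The witness is the infimum of [{F > a}], the right end of the level set [{F = a}]. The quantile
    is its left end and would fail the equivalence when [F] is flat at level [a]. *)
Lemma lt_cdf_threshold Z (a : R) : measurable_fun setT Z -> atomless P Z ->
  0 < a < 1 ->
  exists2 m, Defs.cdf P Z m = a & forall t, (a < Defs.cdf P Z t) = (m < t).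
Proof.
move=> mZ aZ /andP[a0 a1]; pose D := [set t | a < Defs.cdf P Z t].
have Fm : Defs.cdf P Z (inf D) = a.
  apply: cdf_inf => //.
  - exact: cdf_gt_exists.
  - have [r rP] := cdf_has_lbound mZ a0.
    by exists r => t /= /ltW; exact: rP.
  - by move=> t /ltW.
  - by move=> t /negP; rewrite -leNgt.
exists (inf D) => // t; apply/idP/idP.
  by rewrite -{1}Fm; apply: contraTT; rewrite -!leNgt; exact: cdf_homo.
move=> /inf_lt[|r /= ar rt]; first exact: cdf_gt_exists.
by rewrite (lt_le_trans ar)// cdf_homo// ltW.
Qed.

(** Uniformity of [F(Z)]: with [m] the threshold of level [a], the complementary event is
    [{Z <= m}], of mass [F(m) = a]. *)
Lemma prob_cdf_gt Z (a : R) : measurable_fun setT Z -> atomless P Z ->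
  0 < a < 1 -> prob P [set w | a < Defs.cdf P Z (Z w)] = 1 - a.
Proof.
move=> mZ aZ a01; have [m <- mP] := lt_cdf_threshold mZ aZ a01.
rewrite -probC; last exact: measurable_set_ler.
congr prob; apply/seteqP; split => w /=.
  by rewrite mP => mw; apply/negP; rewrite -ltNge.
by move/negP; rewrite -ltNge mP.
Qed.

End Prob.

(** * Comparison of integrals: Neyman-Pearson, layer cake, and the function [Phi] *)

Section Comparison.
Set Implicit Arguments.
Unset Strict Implicit.
Context {R : realType} {d : measure_display} {T : measurableType d}.
Variable P : probability T R.
Implicit Types (A B : set T) (Z f g : T -> R).

(* Neyman-Pearson: among events of equal mass, a superlevel set of [f]
   maximizes the integral of [f]. *)
Lemma integral_superlevel_max (f : T -> R) A B (c : R) :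
  measurable_fun setT f -> (forall w, 0 <= f w) ->
  measurable A -> measurable B -> P A = P B -> 0 <= c ->
  (forall w, B w -> c <= f w) -> (forall w, ~ B w -> f w <= c) ->
  (\int[P]_(w in A) (f w)%:E <= \int[P]_(w in B) (f w)%:E)%E.
Proof.
move=> mf f0 mA mB PAB c0 Bf fB.
have mfE D : measurable_fun D (EFin \o f).
  exact/measurable_EFinP/measurable_funTS.
have f0E (D : set T) w : D w -> (0 <= (f w)%:E)%E by rewrite lee_fin.
have mAB := measurableD mA mB; have mBA := measurableD mB mA.
have mI := measurableI _ _ mA mB.
rewrite -[in leLHS](setUIDK A B) -[in leRHS](setUIDK B A) (setIC B A).
rewrite !ge0_integral_setU//; first last.
- by apply/disj_setPS => w /= [[Aw Bw] []].
- exact: f0E.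
- by apply/disj_setPS => w /= [[Aw Bw] []].
- exact: f0E.
(* The part common to [A] and [B] cancels. The two differences have equal mass, and the constant [c]
   separates the values of [f] on them. *)
apply: leeD2l; apply: (@le_trans _ _ (\int[P]_(w in A `\` B) c%:E)%E).
  by apply: ge0_le_integral => // [w _|w [_ nBw]]; rewrite lee_fin// fB.
apply: (@le_trans _ _ (\int[P]_(w in B `\` A) c%:E)%E); last first.
  by apply: ge0_le_integral => // w [Bw _]; rewrite lee_fin// Bf.
have Poo C : measurable C -> (P C < +oo)%E.
  by move=> mC; rewrite -ge0_fin_numE// fin_num_measure.
rewrite !integral_cst//=.
suff -> : P (A `\` B) = P (B `\` A) by [].
have PD C D : measurable C -> measurable D ->
    P (C `\` D) = (P C - P (C `&` D))%E.
  by move=> mC mD; exact: measureD (Poo _ mC).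
by rewrite !PD// PAB (setIC B A).
Qed.

(** Layer cake: the integral of a nonnegative function is the integral over [r >= 0] of its tail, so
    it inherits the order of the tails. *)
Lemma ge0_le_integral_tail f g :
  measurable_fun setT f -> measurable_fun setT g ->
  (forall w, 0 <= f w) -> (forall w, 0 <= g w) ->
  (forall r : R, 0 <= r ->
    (P [set w | (r < f w)%R] <= P [set w | (r < g w)%R])%E) ->
  (\int[P]_w (f w)%:E <= \int[P]_w (g w)%:E)%E.
Proof.
move=> mf mg f0 g0 fg.
pose fr : {RV P >-> R} := mfun_Sub (mem_set mf).
pose gr : {RV P >-> R} := mfun_Sub (mem_set mg).
have := ge0_expectation_ccdf (X := fr) f0; rewrite unlock => /= ->.
have := ge0_expectation_ccdf (X := gr) g0; rewrite unlock => /= ->.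
have ccdfE h r : ccdf (h : {RV P >-> R}) r = P [set w | r < h w].
  rewrite /ccdf /distribution /pushforward; congr (P _).
  by apply/seteqP; split => w /=; rewrite in_itv/= andbT.
apply: ge0_le_integral => //.
- by apply: measurable_funTS; exact: ccdf_measurable.
- by apply: measurable_funTS; exact: ccdf_measurable.
- by move=> r /=; rewrite in_itv/= andbT => r0; rewrite !ccdfE; exact: fg.
Qed.

Lemma Phi_ge0 (u v : R) : u <= 1 -> 0 <= Phi u v.
Proof.
rewrite -subr_ge0 /Phi => u1; case: ifPn => // /(le_lt_trans u1) v0.
exact: ltW.
Qed.

(** The cutoff [1 - u] is nonnegative, so the jump from 0 there goes upwards. *)
Lemma Phi_homo (u : R) : u <= 1 -> {homo Phi u : v v' / v <= v'}.
Proof.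
move=> u1 v v' vv'; rewrite {1}/Phi; case: ifPn => uv; last exact: Phi_ge0.
by rewrite /Phi (lt_le_trans uv).
Qed.

(** Since [r >= 0], the branch where [Phi] vanishes never exceeds [r]; tails of [Phi] thus become
    tails of its argument. *)
Lemma Phi_gtE (u r v : R) : 0 <= r ->
  (r < Phi u v) = (Num.max r (1 - u) < v).
Proof.
move=> r0; rewrite gt_max /Phi; case: ifPn => [uv|]; first by rewrite andbT.
by move=> _; rewrite andbF; apply/negbTE; rewrite -leNgt.
Qed.

Lemma measurable_cdf Z : measurable_fun setT Z ->
  measurable_fun setT (Defs.cdf P Z).
Proof.
by move=> mZ; apply: nondecreasing_measurable => //; exact: cdf_homo.
Qed.

Lemma measurable_Phi (u : R) : u <= 1 -> measurable_fun setT (Phi u).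
Proof.
by move=> u1; apply: nondecreasing_measurable => //; exact: Phi_homo.
Qed.

End Comparison.

(** * Optimality of the scores in [Sstar] *)

Section Optimality.
Set Implicit Arguments.
Unset Strict Implicit.
Context {R : realType} {d : measure_display} {T : measurableType d}
        {dx : measure_display} {Xs : measurableType dx}.
Variables (P : probability T R) (X : T -> Xs) (Y : T -> R) (eta : Xs -> R).
Variable u0 : R.
Hypothesis mX : measurable_fun setT X.
Hypothesis mY : measurable_fun setT Y.
Hypothesis u0_itv : 0 < u0 < 1.
Implicit Type s : Xs -> R.

Let u0_le1 : u0 <= 1. Proof. by case/andP: u0_itv => _ /ltW. Qed.

Let u0C_itv : 0 < 1 - u0 < 1.
Proof. by case/andP: u0_itv => *; apply/andP; split; lra. Qed.

Let Phi_cdf_Y s w := Phi u0 (Defs.cdf P (s \o X) (s (X w))) * (Y w == 1)%:R.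

Lemma Phi_cdf_Y_ge0 s w : 0 <= Phi_cdf_Y s w.
Proof. by rewrite mulr_ge0// Phi_ge0. Qed.

Lemma measurable_cdf_score s : measurable_fun setT s ->
  measurable_fun setT (fun x => Defs.cdf P (s \o X) (s x)).
Proof.
move=> ms; apply: (measurableT_comp _ ms); apply: measurable_cdf.
exact: measurableT_comp.
Qed.

Lemma measurable_Phi_cdf_Y s : measurable_fun setT s ->
  measurable_fun setT (Phi_cdf_Y s).
Proof.
move=> ms; apply: measurable_funM.
  apply: (measurableT_comp (measurable_Phi u0_le1)).
  exact: (measurableT_comp (measurable_cdf_score ms)).
rewrite (_ : (fun w => _) = \1_(Y @^-1` [set 1])).
  by apply: measurable_indic; exact: measurable_preimage.
apply/funext => w; rewrite indicE.
by case: eqP => Y1; [rewrite mem_set | rewrite memNset].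
Qed.

Lemma integral_Phi_cdf_Y_fin_num s : measurable_fun setT s ->
  (\int[P]_w (Phi_cdf_Y s w)%:E)%E \is a fin_num.
Proof.
move=> ms; rewrite ge0_fin_numE; last first.
  by apply: integral_ge0 => w _; rewrite lee_fin Phi_cdf_Y_ge0.
apply: (@le_lt_trans _ _ (\int[P]_w 1%:E)%E); last first.
  by rewrite integral_cst//= mul1e probability_setT ltry.
apply: ge0_le_integral => //.
- by move=> w _; rewrite lee_fin Phi_cdf_Y_ge0.
- by apply/measurable_EFinP; exact: measurable_Phi_cdf_Y.
- move=> w _; rewrite lee_fin mulr_ile1 ?Phi_ge0//; last by case: eqP.
  rewrite /Phi; case: ifP => // _; apply: cdfr_le1.
  exact: measurableT_comp.
Qed.

(** This gives a tail event the shape that [regression] turns into an integral of [eta(X)]. *)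
Lemma Phi_cdf_Y_gtE s (r : R) : 0 <= r ->
  [set w | r < Phi_cdf_Y s w] =
  X @^-1` [set x | Num.max r (1 - u0) < Defs.cdf P (s \o X) (s x)]
  `&` [set w | Y w = 1].
Proof.
move=> r0; apply/seteqP; split => w /=; rewrite /Phi_cdf_Y.
  have [Y1|_] := eqVneq (Y w) 1; first by rewrite mulr1 Phi_gtE.
  by rewrite mulr0 ltNge r0.
by move=> [r_lt ->]; rewrite eqxx mulr1 Phi_gtE.
Qed.

Hypothesis reg : regression P X Y eta.
Hypothesis eta_atomless : atomless P (eta \o X).

Let meta : measurable_fun setT eta. Proof. by case: reg. Qed.
Let eta_ge0 x : 0 <= eta x. Proof. by case: reg => _ [/(_ x)/andP[]]. Qed.
Let metaX : measurable_fun setT (eta \o X). Proof. exact: measurableT_comp. Qed.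

(* Outside [Cset X eta u0] both cdfs are at most [1 - u0]; inside they agree. *)
Lemma Sstar_cdf_gtE (sstar : Xs -> R) (a : R) x :
  measurable_fun setT sstar -> Sstar P X eta u0 sstar -> 1 - u0 <= a ->
  (a < Defs.cdf P (sstar \o X) (sstar x)) = (a < Defs.cdf P (eta \o X) (eta x)).
Proof.
move=> msstar [sC snC] u0a; set q := quantile P (eta \o X) (1 - u0).
have Hq : Defs.cdf P (eta \o X) q = 1 - u0 by exact: cdf_quantile.
have infP y : Cset P X eta u0 y -> inf (eta @` Cset P X eta u0) <= eta y.
  by move=> Cy; apply: ge_inf; [exists 0 => _ [z _ <-] | exists y].
have [Cx|nCx] := pselect (Cset P X eta u0 x).
  (* Inside [Cset] the two sublevel events coincide: a point outside [Cset] lies below [x] for both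
     scores, and a point inside has the same value under both. *)
  congr (_ < prob P _); apply/seteqP; split => w /=; rewrite (sC x Cx).
    have [/sC ->//|nCw] := pselect (Cset P X eta u0 (X w)) => _.
    by apply/ltW/(lt_le_trans _ Cx); rewrite ltNge; exact/negP.
  have [/sC ->//|/snC nCw] := pselect (Cset P X eta u0 (X w)) => _.
  by apply/ltW/(lt_le_trans nCw); exact: infP.
have mlt := measurable_set_ltr metaX (measurable_cst q).
rewrite [RHS]ltNge (le_trans _ u0a)/=; last first.
  rewrite -Hq; apply: cdf_homo => //; apply: ltW.
  by rewrite ltNge; exact/negP.
apply/negbTE; rewrite -leNgt (le_trans _ u0a)// -Hq.
(* A score [sstar(X) <= sstar x] with [x] outside [Cset] forces [X] outside [Cset], that is
   [eta(X) < q]; atomlessness gives this strict event the mass [1 - u0]. *)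
rewrite -(atomless_lt q metaX eta_atomless).
have mle : measurable [set w | (sstar \o X) w <= sstar x].
  by apply: measurable_set_ler => //; exact: measurableT_comp.
apply: (le_prob P mle mlt).
move=> w /= swx; rewrite ltNge; apply/negP => Cw.
move: swx; rewrite leNgt => /negP; apply.
by rewrite (lt_le_trans (snC _ nCx))// sC// infP.
Qed.

(** By uniformity both conditions on [X] have mass [1 - a]. The one for [sstar] is the one for
    [eta], hence a superlevel set of [eta], and Neyman-Pearson applies. *)
Lemma prob_cdf_gt_le (s sstar : Xs -> R) (a : R) :
  measurable_fun setT s -> atomless P (s \o X) ->
  measurable_fun setT sstar -> Sstar P X eta u0 sstar ->
  1 - u0 <= a < 1 ->
  (P (X @^-1` [set x | (a < Defs.cdf P (s \o X) (s x))%R]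
      `&` [set w | (Y w = 1)%R]) <=
   P (X @^-1` [set x | (a < Defs.cdf P (sstar \o X) (sstar x))%R]
      `&` [set w | (Y w = 1)%R]))%E.
Proof.
move=> ms as_ msstar Ssstar /andP[u0a a1].
have a01 : 0 < a < 1.
  by case/andP: u0C_itv => /lt_le_trans/(_ u0a) -> _.
have msX : measurable_fun setT (s \o X) by exact: measurableT_comp.
have mlt f : measurable_fun setT f ->
    measurable [set x | a < Defs.cdf P (f \o X) (f x)].
  move=> mf; apply: measurable_set_ltr => //; exact: measurable_cdf_score.
have -> : [set x | a < Defs.cdf P (sstar \o X) (sstar x)] =
    [set x | a < Defs.cdf P (eta \o X) (eta x)].
  by apply/seteqP; split => x /=; rewrite Sstar_cdf_gtE.
case: reg => _ [_ regE]; rewrite !regE; [|exact: mlt..].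
have [m _ mP] := lt_cdf_threshold metaX eta_atomless a01.
(* The maximum with 0 makes the constant visibly nonnegative; as [eta >= 0], it still bounds [eta]
   from below on the superlevel set. *)
apply: (integral_superlevel_max (c := Num.max m 0)) => //.
- exact: measurable_preimage (mlt _ ms).
- exact: measurable_preimage (mlt _ meta).
- rewrite -!prob_EFin; [|exact: measurable_preimage (mlt _ _)..].
  by rewrite (prob_cdf_gt msX)// (prob_cdf_gt metaX).
- by rewrite le_max lexx orbT.
- by move=> w /=; rewrite (mP (eta (X w))) => mw; rewrite ge_max ltW// eta_ge0.
- move=> w /= /negP; rewrite (mP (eta (X w))) -leNgt => mw.
  by rewrite le_max mw.
Qed.

Lemma Wcrit_le_Sstar (s sstar : Xs -> R) : 0 < ppos P Y ->
  measurable_fun setT s -> atomless P (s \o X) ->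
  measurable_fun setT sstar -> Sstar P X eta u0 sstar ->
  Wcrit P X Y s u0 <= Wcrit P X Y sstar u0.
Proof.
move=> p0 ms as_ msstar Ssstar; rewrite ler_pM2r ?invr_gt0// fine_le//;
  [exact: integral_Phi_cdf_Y_fin_num..|].
apply: ge0_le_integral_tail.
- exact: measurable_Phi_cdf_Y.
- exact: measurable_Phi_cdf_Y.
- exact: Phi_cdf_Y_ge0.
- exact: Phi_cdf_Y_ge0.
move=> r r0; rewrite (Phi_cdf_Y_gtE s r0) (Phi_cdf_Y_gtE sstar r0).
have [a1|a1] := ltP (Num.max r (1 - u0)) 1.
  by apply: prob_cdf_gt_le => //; rewrite a1 le_max lexx orbT.
(* At levels of at least 1 the left event is empty, since a cdf never exceeds 1. *)
rewrite (_ : X @^-1` _ = set0) ?set0I ?measure0//.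
apply/seteqP; split => // w /= /(le_lt_trans a1); apply/negP; rewrite -leNgt.
by apply: cdfr_le1; exact: measurableT_comp.
Qed.

End Optimality.

(** * The unnormalised law of a variable on an event *)

Section RestrictedLaw.
Set Implicit Arguments.
Unset Strict Implicit.
Context {R : realType} {d : measure_display} {T : measurableType d}
        {dv : measure_display} {V : measurableType dv}.
Variable P : probability T R.

(** The restricted measure gives no mass to the complement of [D] and agrees with [P] on subsets of
    [D]. *)
Lemma ge0_integral_mrestr (D : set T) (mD : measurable D) (f : T -> \bar R) :
  measurable_fun setT f -> (forall w, (0 <= f w)%E) ->
  (\int[mrestr P mD]_w f w = \int[P]_(w in D) f w)%E.
Proof.
move=> mf f0.
rewrite (@ge0_negligible_integral _ _ _ _ setT (~` D))//; first last.
- by rewrite /= /mrestr setICl measure0.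
- exact: measurableC.
rewrite setTD setCK; apply: eq_measure_integral => A mA AD.
by rewrite /= /mrestr setIidl.
Qed.

(** The witness is the image under [U] of [P] restricted to [D], packed as a finite measure so that
    products of such laws can be formed. *)
Lemma restricted_law_exists (U : T -> V) (D : set T) :
  measurable_fun setT U -> measurable D ->
  exists2 m : {finite_measure set V -> \bar R},
    (forall A, m A = P (U @^-1` A `&` D)) &
    forall f : V -> \bar R, measurable_fun setT f -> (forall y, (0 <= f y)%E) ->
      (\int[m]_y f y = \int[P]_(w in D) f (U w))%E.
Proof.
move=> mU mD.
(* The canonical measure structure abstracts over the measurability proof. *)
pose pushforwardU : {measure set V -> \bar R} := pushforward (mrestr P mD) U.
pose m0 := pushforwardU mU.
have fin0 : fin_num_fun m0.
  move=> A mA; rewrite /m0 /= /pushforward /mrestr fin_num_measure//.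
  by apply: measurableI => //; exact: measurable_preimage.
pose mfin := Measure_isFinite.Build _ _ _ (m0 : set V -> \bar R) fin0.
pose m : {finite_measure set V -> \bar R} :=
  HB.pack (m0 : set V -> \bar R) (Measure.class m0) mfin.
exists m => // f mf f0.
rewrite -(ge0_integral_mrestr mD (measurableT_comp mf mU)); last first.
  by move=> w; exact: f0.
exact: (ge0_integral_pushforward mU (mrestr P mD) measurableT mf).
Qed.

End RestrictedLaw.

(** * Joint laws that factor on rectangles *)

Section JointLaw.
Set Implicit Arguments.
Unset Strict Implicit.
Context {R : realType} {d : measure_display} {T : measurableType d}.
Context {d1 d2 : measure_display}.
Context {V1 : measurableType d1} {V2 : measurableType d2}.
Variable P : probability T R.

(** The law of the pair on [D] agrees with the product measure on rectangles, hence everywhere; the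
    right side is that product measure computed by sections. *)
Lemma joint_law_product (U1 : T -> V1) (U2 : T -> V2) (D : set T)
    (m1 : {finite_measure set V1 -> \bar R})
    (m2 : {finite_measure set V2 -> \bar R}) (C : set (V1 * V2)) :
  measurable_fun setT U1 -> measurable_fun setT U2 -> measurable D ->
  (forall A B, measurable A -> measurable B ->
    P (U1 @^-1` A `&` U2 @^-1` B `&` D) = (m1 A * m2 B)%E) ->
  measurable C ->
  P ([set w | C (U1 w, U2 w)] `&` D) = (\int[m1]_x m2 (xsection C x))%E.
Proof.
move=> mU1 mU2 mD indep mC.
have [m mE _] := restricted_law_exists P (measurable_fun_pair mU1 mU2) mD.
transitivity (m C); first by rewrite mE.
apply/esym/product_measure_unique => // A B mA mB.
by rewrite /= mE -indep//; congr (P (_ `&` _)); apply/seteqP; split.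
Qed.

End JointLaw.

(** * Fubini and exchangeability for two independent copies *)

Section Independence.
Set Implicit Arguments.
Unset Strict Implicit.
Context {R : realType} {d : measure_display} {T : measurableType d}
        {dv : measure_display} {V : measurableType dv}.
Variables (P : probability T R) (U U' : T -> V) (D D' : set T).
Hypotheses (mU : measurable_fun setT U) (mU' : measurable_fun setT U').
Hypotheses (mD : measurable D) (mD' : measurable D').
Hypothesis indep : forall A A', measurable A -> measurable A' ->
  P (U @^-1` A `&` D `&` (U' @^-1` A' `&` D')) =
  (P (U @^-1` A `&` D) * P (U' @^-1` A' `&` D'))%E.

(** Fubini with the first copy frozen at [U w]. The events [D] and [D'] carry the label conditions,
    with the full space for none. *)
Lemma indep_prob_section (C : set (V * V)) : measurable C ->
  P ([set w | C (U w, U' w)] `&` (D `&` D')) =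
  (\int[P]_(w in D) P ([set w' | C (U w, U' w')] `&` D'))%E.
Proof.
move=> mC; have [m mE mint] := restricted_law_exists P mU mD.
have [m' mE' _] := restricted_law_exists P mU' mD'.
rewrite (joint_law_product (m1 := m) (m2 := m') mU mU' _ _ mC).
- rewrite mint; last by [].
    by apply: eq_integral => w _; rewrite mE' xsectionE.
  exact: measurable_fun_xsection.
- exact: measurableI.
- by move=> A B mA mB; rewrite mE mE' -indep// setIACA.
Qed.

(** Both orders of the pair have, on the common event, the same joint law: the product of [m] with
    itself. *)
Lemma indep_prob_swap (C : set (V * V)) : measurable C ->
  (forall A, measurable A -> P (U @^-1` A `&` D) = P (U' @^-1` A `&` D')) ->
  P ([set w | C (U w, U' w)] `&` (D `&` D')) =
  P ([set w | C (U' w, U w)] `&` (D `&` D')).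
Proof.
move=> mC same; have [m mE _] := restricted_law_exists P mU mD.
have mE' A : measurable A -> m A = P (U' @^-1` A `&` D').
  by move=> mA; rewrite mE same.
have mDD := measurableI _ _ mD mD'.
rewrite (joint_law_product (m1 := m) (m2 := m) mU mU' mDD _ mC).
  rewrite (joint_law_product (m1 := m) (m2 := m) mU' mU mDD _ mC)//.
  move=> A B mA mB; rewrite muleC mE mE'// -indep//.
  by rewrite [U' @^-1` A `&` _]setIC setIACA.
by move=> A B mA mB; rewrite {1}mE mE'// -indep// setIACA.
Qed.

End Independence.

(** * Decomposition of the criterion into [beta] and [LocAUC] *)

Section Decomposition.
Set Implicit Arguments.
Unset Strict Implicit.
Context {R : realType} {d : measure_display} {T : measurableType d}
        {dx : measure_display} {Xs : measurableType dx}.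
Variables (P : probability T R) (X X' : T -> Xs) (Y Y' : T -> R).
Variables (s : Xs -> R) (u0 : R).
Hypotheses (mX : measurable_fun setT X) (mX' : measurable_fun setT X').
Hypotheses (mY : measurable_fun setT Y) (mY' : measurable_fun setT Y').
Hypothesis Y'_pm1 : forall w, Y' w = 1 \/ Y' w = -1.
Hypothesis icopy : indep_copy P X X' Y Y'.
Hypothesis p_itv : 0 < ppos P Y < 1.
Hypothesis u0_itv : 0 < u0 < 1.
Hypothesis ms : measurable_fun setT s.
Hypothesis s_atomless : atomless P (s \o X).

Let Z := s \o X.
Let Z' := s \o X'.
Let mZ : measurable_fun setT Z. Proof. exact: measurableT_comp. Qed.
Let mZ' : measurable_fun setT Z'. Proof. exact: measurableT_comp. Qed.

Let pos := Y @^-1` [set 1].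
Let pos' := Y' @^-1` [set 1].
Let neg' := Y' @^-1` [set -1].
Let mpos : measurable pos. Proof. exact: measurable_preimage. Qed.
Let mpos' : measurable pos'. Proof. exact: measurable_preimage. Qed.
Let mneg' : measurable neg'. Proof. exact: measurable_preimage. Qed.

Let setC_pos' : ~` pos' = neg'.
Proof.
apply/seteqP; split => w /=; first by case: (Y'_pm1 w).
by rewrite /pos' /neg' /= => -> /eqP; rewrite -subr_eq0 => /eqP; lra.
Qed.

Let same_law (A B : set R) : measurable A -> measurable B ->
  P (Z @^-1` A `&` Y @^-1` B) = P (Z' @^-1` A `&` Y' @^-1` B).
Proof.
move=> mA mB; case: icopy => same _.
exact: same (measurable_preimage ms mA) mB.
Qed.

Let indepZ (B B' : set R) : measurable B -> measurable B' ->
  forall A A', measurable A -> measurable A' ->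
  P (Z @^-1` A `&` Y @^-1` B `&` (Z' @^-1` A' `&` Y' @^-1` B')) =
  (P (Z @^-1` A `&` Y @^-1` B) * P (Z' @^-1` A' `&` Y' @^-1` B'))%E.
Proof.
move=> mB mB' A A' mA mA'; case: icopy => _ indep.
exact: indep (measurable_preimage ms mA) mB (measurable_preimage ms mA') mB'.
Qed.

Let prob_indep (A A' B B' : set R) :
  measurable A -> measurable A' -> measurable B -> measurable B' ->
  prob P (Z @^-1` A `&` Y @^-1` B `&` (Z' @^-1` A' `&` Y' @^-1` B')) =
  prob P (Z @^-1` A `&` Y @^-1` B) * prob P (Z @^-1` A' `&` Y @^-1` B').
Proof.
move=> mA mA' mB mB'; apply: EFin_inj.
have mZA C D : measurable C -> measurable D ->
    measurable (Z @^-1` C `&` Y @^-1` D).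
  by move=> mC mD; apply: measurableI; exact: measurable_preimage.
have mZA' C D : measurable C -> measurable D ->
    measurable (Z' @^-1` C `&` Y' @^-1` D).
  by move=> mC mD; apply: measurableI; exact: measurable_preimage.
rewrite EFinM !prob_EFin//; [|exact: mZA..|]; last first.
  by apply: measurableI; [exact: mZA|exact: mZA'].
by rewrite indepZ// -(same_law mA' mB').
Qed.

Let prob_cdf' t : P [set w | Z' w <= t] = (Defs.cdf P Z t)%:E.
Proof.
rewrite prob_EFin; last exact: measurable_set_ler.
have := @same_law `]-oo, t] setT; by rewrite !preimage_setT !setIT => <-.
Qed.

(** By Fubini with no label condition: for fixed [w] the copy hits the value [Z w] with the
    probability that [Z] does, which is 0. *)
Let ties_negligible : P [set w | Z w = Z' w] = 0%E.
Proof.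
pose C : set (R * R) := [set z | z.1 = z.2].
have mC : measurable C.
  by apply: measurable_set_eqr; [exact: measurable_fst|exact: measurable_snd].
have := indep_prob_section mZ mZ' (measurable_preimage mY measurableT)
  (measurable_preimage mY' measurableT) (indepZ measurableT measurableT) mC.
rewrite !preimage_setT !setIT => ->; apply: integral0_eq => w _.
rewrite setIT; have := @same_law [set Z w] setT (measurable_set1 _) measurableT.
rewrite !preimage_setT !setIT => lawZ.
transitivity (P (Z' @^-1` [set Z w])); last by rewrite -lawZ; exact: s_atomless.
by congr (P _); apply/seteqP; split => w' /=.
Qed.

Let q := quantile P Z (1 - u0).

Let u0C_itv : 0 < 1 - u0 < 1.
Proof. by case/andP: u0_itv => *; apply/andP; split; lra. Qed.

(* [q] and [m] are the two ends of the level set [F = 1 - u0]: [beta] and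
   [LocAUC] cut at [q], whereas [Phi] cuts at [m]. *)
Variable m : R.
Hypothesis cdf_m : Defs.cdf P Z m = 1 - u0.
Hypothesis cdf_gt_m : forall t, (1 - u0 < Defs.cdf P Z t) = (m < t).

Let q_le_m : q <= m.
Proof.
apply: ge_inf; last by rewrite /= cdf_m.
by apply: cdf_has_lbound => //; case/andP: u0C_itv.
Qed.

(** The cdf equals [1 - u0] at both [q] and [m], so nothing is left for the interval between
    them. *)
Let flat_negligible : P [set w | q <= Z w /\ Z w <= m] = 0%E.
Proof.
have mle := measurable_set_ler mZ (measurable_cst m).
have mge := measurable_set_ler (measurable_cst q) mZ.
rewrite -prob_EFin; last exact: measurableI.
have := prob_split P mle mge; rewrite -[prob P _]/(Defs.cdf P Z m) cdf_m.
have -> : [set w | Z w <= m] `&` ~` [set w | q <= Z w] = [set w | Z w < q].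
  apply/seteqP; split => w /=; first by case=> _ /negP; rewrite -ltNge.
  move=> Zq; split; first exact/ltW/(lt_le_trans Zq).
  by apply/negP; rewrite -ltNge.
rewrite (atomless_lt q mZ s_atomless) cdf_quantile//.
move=> /(congr1 (fun x => x - (1 - u0))).
by rewrite subrr addrK setIC => <-.
Qed.

Let wins := [set w | Z' w <= Z w].
Let high := [set w | m < Z w].
Let high' := [set w | m < Z' w].
Let mwins : measurable wins. Proof. exact: measurable_set_ler. Qed.
Let mhigh : measurable high. Proof. exact: measurable_set_ltr. Qed.
Let mhigh' : measurable high'. Proof. exact: measurable_set_ltr. Qed.

(** For fixed [w], [F(Z w)] is the probability that the copy scores at most [Z w], so the integrand
    is the mass of a section of [{Z' <= Z, m < Z}] and Fubini reassembles the event. *)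
Lemma integral_Phi_rank :
  (\int[P]_w (Phi u0 (Defs.cdf P Z (Z w)) * (Y w == 1)%:R)%:E)%E =
  P (wins `&` high `&` pos).
Proof.
pose C : set (R * R) := [set z | z.2 <= z.1] `&` [set z | m < z.1].
have mC : measurable C.
  apply: measurableI.
    by apply: measurable_set_ler; [exact: measurable_snd|exact: measurable_fst].
  by apply: measurable_set_ltr => //; exact: measurable_fst.
have := indep_prob_section mZ mZ' mpos
  (measurable_preimage mY' measurableT)
  (indepZ (measurable_set1 1) measurableT) mC.
rewrite preimage_setT setIT => ->.
rewrite [RHS]integral_mkcond; apply: eq_integral => w _; rewrite patchE.
have [Y1|Y1] := eqVneq (Y w) 1; last first.
  by rewrite mulr0 memNset//; exact/eqP.
rewrite mem_set// mulr1 setIT /Phi cdf_gt_m.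
case: ifPn => mZw.
  by rewrite -prob_cdf'; congr (P _); apply/seteqP; split => w' /=; [|case].
rewrite (_ : [set _ | _] = set0) ?measure0//.
by apply/seteqP; split => // w' [_ /=]; exact/negP.
Qed.

(** [b] turns out to be [p * beta]. In [c] both copies score above [m], since [wins] and [high']
    together imply [high]. *)
Let b := prob P (high `&` pos).
Let c := prob P (wins `&` high' `&` (pos `&` pos')).

Lemma prob_swap_wins :
  prob P ([set w | Z w <= Z' w] `&` high `&` (pos `&` pos')) = c.
Proof.
pose C : set (R * R) := [set z | z.2 <= z.1] `&` [set z | m < z.2].
have mC : measurable C.
  apply: measurableI.
    by apply: measurable_set_ler; [exact: measurable_snd|exact: measurable_fst].
  by apply: measurable_set_ltr => //; exact: measurable_snd.
have := indep_prob_swap mZ mZ' mpos mpos'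
  (indepZ (measurable_set1 1) (measurable_set1 1)) mC.
by rewrite /c /prob => <- // A mA; exact: same_law.
Qed.

(** Independence makes [b * b] the mass of both copies being high and positive. Splitting by the
    winner gives [c] and, up to ties, its image under the exchange of copies. *)
Lemma prob_high_high : b * b = c + c.
Proof.
have -> : b * b = prob P (high `&` high' `&` (pos `&` pos')).
  rewrite setIACA.
  have := @prob_indep `]m, +oo[ `]m, +oo[ [set 1] [set 1].
  have -> : Z @^-1` `]m, +oo[ = high.
    by apply/seteqP; split => w /=; rewrite in_itv/= andbT.
  have -> : Z' @^-1` `]m, +oo[ = high'.
    by apply/seteqP; split => w /=; rewrite in_itv/= andbT.
  by move=> <-.
have mall : measurable (high `&` high' `&` (pos `&` pos')).
  by apply: measurableI; exact: measurableI.
rewrite (prob_split P mall mwins); congr (_ + _).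
  rewrite /c; congr prob; apply/seteqP; split => w /= [[]].
    by move=> [_ ?] ? ?.
  by move=> w1 h' pp; do ?split => //; exact: lt_le_trans h' w1.
rewrite -prob_swap_wins.
apply: (prob_negligible_eq (N := [set w | Z w = Z' w])) => //.
- by apply: measurableI => //; exact: measurableC.
- by apply: measurableI; apply: measurableI => //; exact: measurable_set_ler.
- exact: measurable_set_eqr.
apply/seteqP; split => w /=.
  move=> [[[[hi hi'] pp] nw] ne]; split => //; split => //; split => //.
  by apply: ltW; rewrite ltNge; exact/negP.
move=> [[[le hi] pp] ne]; split => //; split; last first.
  by apply/negP; rewrite -ltNge lt_neqAle le andbT; exact/eqP.
by split => //; split => //; exact: lt_le_trans hi le.
Qed.

(** Split by whether the copy is high. If it is not, then [Z' <= m < Z] and the win is automatic, so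
    independence gives a product. *)
Lemma prob_wins_pos_pos :
  prob P (wins `&` high `&` (pos `&` pos')) = c + b * (ppos P Y - b).
Proof.
have mall : measurable (wins `&` high `&` (pos `&` pos')).
  by apply: measurableI; exact: measurableI.
rewrite (prob_split P mall mhigh'); congr (_ + _).
  rewrite /c; congr prob; apply/seteqP; split => w /=.
    by move=> [[[w1 h] pp] h'].
  by move=> [[w1 h'] pp]; do ?split => //; exact: lt_le_trans h' w1.
have low : prob P (Z @^-1` `]-oo, m] `&` pos) = ppos P Y - b.
  have -> : ppos P Y = b + prob P (pos `&` ~` high).
    by rewrite /b setIC; exact: prob_split.
  rewrite addrC addKr; congr prob; rewrite setIC; congr (_ `&` _).
  apply/seteqP; split => w /=.
    by rewrite in_itv/= leNgt => /negP.
  by move/negP; rewrite -leNgt in_itv.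
rewrite -low; have := @prob_indep `]m, +oo[ `]-oo, m] [set 1] [set 1].
have -> : Z @^-1` `]m, +oo[ = high.
  by apply/seteqP; split => w /=; rewrite in_itv/= andbT.
move=> <-//; congr prob; apply/seteqP; split => w /=.
  by move=> [[[w1 h] [p p']] /negP]; rewrite -leNgt in_itv.
rewrite in_itv/= => -[[h p] [l p']]; split.
  by split => //; split => //; exact/ltW/(le_lt_trans l h).
by apply/negP; rewrite -leNgt.
Qed.

(** The events differ only by ties (weak against strict win) and by the flat stretch from [q] to
    [m], both null. *)
Lemma prob_wins_pos_neg :
  prob P (wins `&` high `&` (pos `&` neg')) =
  prob P [set w | s (X' w) < s (X w) /\ q <= s (X w) /\ Y w = 1 /\ Y' w = -1].
Proof.
pose N := [set w | Z w = Z' w] `|` [set w | q <= Z w /\ Z w <= m].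
have meqv : measurable [set w | Z w = Z' w] by exact: measurable_set_eqr.
have mflat : measurable [set w | q <= Z w /\ Z w <= m].
  by apply: measurableI; exact: measurable_set_ler.
apply: (prob_negligible_eq (N := N)).
- by do ?apply: measurableI.
- apply: measurableI; first exact: measurable_set_ltr mZ' mZ.
  by apply: measurableI; [exact: measurable_set_ler|exact: measurableI].
- exact: measurableU.
- by rewrite measureU0.
apply/seteqP; split => w /=.
  move=> [[[w1 h] [p n]] nN]; split => //; split.
    rewrite lt_neqAle w1 andbT; apply/eqP => eqZ.
    by apply: nN; left; exact/esym.
  by split => //; exact/(le_trans q_le_m)/ltW.
move=> [[lt [qZ [p n]]] nN]; split => //; split => //; split; first exact: ltW.
by rewrite /high /= ltNge; apply/negP => Zm; apply: nN; right.
Qed.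

Lemma prob_high_pos : prob P [set w | q <= s (X w) /\ Y w = 1] = b.
Proof.
apply: (prob_negligible_eq (N := [set w | q <= Z w /\ Z w <= m])) => //.
- by apply: measurableI => //; exact: measurable_set_ler.
- exact: measurableI.
- by apply: measurableI; exact: measurable_set_ler.
apply/seteqP; split => w /= [[qZ p] nN]; split => //; split => //.
  by rewrite /high /= ltNge; apply/negP => Zm; apply: nN.
by exact/(le_trans q_le_m)/ltW.
Qed.

Lemma prob_pos_neg :
  prob P [set w | Y w = 1 /\ Y' w = -1] = ppos P Y * (1 - ppos P Y).
Proof.
have same1 : ppos P Y = prob P pos'.
  have := @same_law setT [set 1]; rewrite !preimage_setT !setTI /ppos /prob.
  by move=> /(_ measurableT (measurable_set1 1)) => <-.
have := @prob_indep setT setT [set 1] [set -1].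
rewrite !preimage_setT !setTI => -> //; congr (_ * _).
(* Both factors are read on the copy, whose label takes only the values 1 and -1. *)
rewrite same1 -probC// setC_pos'.
have := @same_law setT [set -1]; rewrite !preimage_setT !setTI /prob.
by move=> ->.
Qed.

Lemma Wcrit_threshold : Wcrit P X Y s u0 =
  ppos P Y / 2 * beta P X Y s u0 * (2 - beta P X Y s u0)
  + (1 - ppos P Y) * LocAUC P X X' Y Y' s u0.
Proof.
case/andP: p_itv => p0 p1.
rewrite /Wcrit /beta /LocAUC integral_Phi_rank prob_pos_neg prob_high_pos.
rewrite -prob_wins_pos_neg -[fine _]/(prob P _).
have mall : measurable (wins `&` high `&` pos) by do ?apply: measurableI.
(* Split by the label of the copy: the positive part yields the [beta] term, the negative part
   [LocAUC]. *)
rewrite (prob_split P mall mpos') setC_pos' -!(setIA (wins `&` high)).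
rewrite prob_wins_pos_pos.
set l := prob P (_ `&` _).
have := prob_high_high; have p_neq0 : ppos P Y != 0 by rewrite gt_eqF.
have p'_neq0 : 1 - ppos P Y != 0 by rewrite subr_eq0 gt_eqF.
set p := ppos P Y in p_neq0 p'_neq0 *; move=> bb.
(* The positive part becomes [b * p - b * b / 2]; divided by [p], with [beta = b / p], it is the
   [beta] term. *)
have -> : c = b * b / 2 by rewrite bb; field.
by field; rewrite p_neq0 p'_neq0.
Qed.

End Decomposition.

Theorem theorem4 (R : realType) (d : measure_display) (T : measurableType d)
  (dx : measure_display) (Xs : measurableType dx) (P : probability T R)
  (X X' : T -> Xs) (Y Y' : T -> R) (eta : Xs -> R) (u0 : R) :
  measurable_fun setT X -> measurable_fun setT X' ->
  measurable_fun setT Y -> measurable_fun setT Y' ->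
  (forall w, Y w = 1 \/ Y w = -1) -> (forall w, Y' w = 1 \/ Y' w = -1) ->
  indep_copy P X X' Y Y' ->
  0 < ppos P Y < 1 ->
  regression P X Y eta ->
  0 < u0 < 1 ->
  atomless P (eta \o X) ->
  (forall s sstar : Xs -> R,
      measurable_fun setT s -> atomless P (s \o X) ->
      measurable_fun setT sstar -> atomless P (sstar \o X) ->
      Sstar P X eta u0 sstar ->
      Wcrit P X Y s u0 <= Wcrit P X Y sstar u0) /\
  (forall s : Xs -> R,
      measurable_fun setT s -> atomless P (s \o X) ->
      Wcrit P X Y s u0 =
        ppos P Y / 2 * beta P X Y s u0 * (2 - beta P X Y s u0)
        + (1 - ppos P Y) * LocAUC P X X' Y Y' s u0).
Proof.
move=> mX mX' mY mY' Y_pm1 Y'_pm1 icopy p_itv reg u0_itv eta_atomless; split.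
  move=> s sstar ms s_atomless msstar _ Ssstar.
  apply: (Wcrit_le_Sstar mX mY u0_itv reg eta_atomless) => //.
  by case/andP: p_itv.
move=> s ms s_atomless.
have u0C_itv : 0 < 1 - u0 < 1.
  by case/andP: u0_itv => *; apply/andP; split; lra.
have [m cdf_m cdf_gt_m] :=
  lt_cdf_threshold (measurableT_comp ms mX) s_atomless u0C_itv.
exact: Wcrit_threshold cdf_gt_m.
Qed.
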